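(* Let $\mathfrak{A}$ be a $C^*$-algebra and let $E$ be a Hilbert $\mathfrak{A}$-module. For every positive operator $t\in\mathcal{L}(E)$ and every $x\in E\setminus\{0\}$, we have $$\|\langle tx,x\rangle\|^r\leq\|x\|^{2(r-1)}\,\|\langle t^rx,x\rangle\|\quad\text{for every real } r\geq 1,$$ $$\|\langle tx,x\rangle\|^r\geq\|x\|^{2(r-1)}\,\|\langle t^rx,x\rangle\|\quad\text{for every real } r \text{ with } 0<r\leq 1.$$
   Context: Hilbert $C^*$-modules are right modules: a Hilbert $\mathfrak{A}$-module $E$ is a complex vector space and right $\mathfrak{A}$-module with an $\mathfrak{A}$-valued inner product $\langle\cdot,\cdot\rangle$ (linear in the second variable, conjugate-linear in the first, with $\langle x,ya\rangle=\langle x,y\rangle a$, $\langle x,y\rangle^*=\langle y,x\rangle$, $\langle x,x\rangle\ge 0$, and $\langle x,x\rangle=0$ only if $x=0$), complete for the norm $\|x\|=\|\langle x,x\rangle\|^{1/2}$. $\mathcal{L}(E)$ denotes the $C^*$-algebra of all adjointable operators on $E$; a positive operator is a positive element of this $C^*$-algebra, and $t^r$ is defined by the continuous functional calculus in $\mathcal{L}(E)$. The $C^*$-algebra $\mathfrak{A}$ is not assumed to be unital. *)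

(* Defs.v *)
From HB Require Import structures.
From mathcomp Require Import all_boot all_order all_algebra complex.
From mathcomp Require Import all_classical all_reals all_analysis.

Set Implicit Arguments.
Unset Strict Implicit.
Unset Printing Implicit Defensive.

Import Order.TTheory GRing.Theory Num.Theory.
Import numFieldNormedType.Exports.

Local Open Scope classical_set_scope.
Local Open Scope ring_scope.
Local Open Scope complex_scope.

(* MathComp rings have a 1, so the product of a C*-algebra, which need not have
   a unit, is a separate operation on a complex Banach space. *)
HB.mixin Record isCStarAlgebra (R : realType) A
    of CompleteNormedModule R[i] A := {
  cmul : A -> A -> A ;
  cstar : A -> A ;
  cmulA : forall a b c, cmul a (cmul b c) = cmul (cmul a b) c ;
  cmulDl : forall a b c, cmul (a + b) c = cmul a c + cmul b c ;
  cmulDr : forall a b c, cmul a (b + c) = cmul a b + cmul a c ;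
  cmulZl : forall (z : R[i]) a b, cmul (z *: a) b = z *: cmul a b ;
  cmulZr : forall (z : R[i]) a b, cmul a (z *: b) = z *: cmul a b ;
  cstarD : forall a b, cstar (a + b) = cstar a + cstar b ;
  cstarZ : forall (z : R[i]) a, cstar (z *: a) = (z^*)%R *: cstar a ;
  cstarK : forall a, cstar (cstar a) = a ;
  cstarM : forall a b, cstar (cmul a b) = cmul (cstar b) (cstar a) ;
  cmul_norm : forall a b, `|cmul a b| <= `|a| * `|b| ;
  cstar_norm : forall a, `|cmul (cstar a) a| = `|a| ^+ 2 }.

#[short(type="cstarAlgType")]
HB.structure Definition CStarAlgebra (R : realType) :=
  {A of isCStarAlgebra R A & CompleteNormedModule R[i] A}.

(* The element z1 + a of the unitization C1 + A has inverse w1 + b. *)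
Definition unitization_inverse (R : realType) (A : cstarAlgType R)
    (z : R[i]) (a : A) (w : R[i]) (b : A) : Prop :=
  [/\ z * w = 1,
      z *: b + w *: a + cmul a b = 0 &
      z *: b + w *: a + cmul b a = 0].

(* The spectrum is the one in the unitization, even if A has a unit: in that
   case this adds at most the point 0, which does not affect positivity. *)
Definition cspectrum (R : realType) (A : cstarAlgType R) (a : A) : set R[i] :=
  [set z | ~ exists w b, unitization_inverse z (- a) w b].

(* In R[i], 0 <= z means that z is real and nonnegative. *)
Definition cpositive (R : realType) (A : cstarAlgType R) (a : A) : Prop :=
  cstar a = a /\ cspectrum a `<=` [set z | 0 <= z].

HB.mixin Record isHilbertModule (R : realType) (A : cstarAlgType R) E
    of CompleteNormedModule R[i] E := {
  hact : E -> A -> E ;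
  hdot : E -> E -> A ;
  hactDl : forall x y a, hact (x + y) a = hact x a + hact y a ;
  hactDr : forall x a b, hact x (a + b) = hact x a + hact x b ;
  hactM : forall x a b, hact x (cmul a b) = hact (hact x a) b ;
  hactZl : forall (z : R[i]) x a, hact (z *: x) a = z *: hact x a ;
  hactZr : forall (z : R[i]) x a, hact x (z *: a) = z *: hact x a ;
  hdotDr : forall x y1 y2, hdot x (y1 + y2) = hdot x y1 + hdot x y2 ;
  hdotZr : forall (z : R[i]) x y, hdot x (z *: y) = z *: hdot x y ;
  hdotDl : forall x1 x2 y, hdot (x1 + x2) y = hdot x1 y + hdot x2 y ;
  hdotZl : forall (z : R[i]) x y, hdot (z *: x) y = (z^*)%R *: hdot x y ;
  hdot_act : forall x y a, hdot x (hact y a) = cmul (hdot x y) a ;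
  hdot_star : forall x y, cstar (hdot x y) = hdot y x ;
  hdot_ge0 : forall x, cpositive (hdot x x) ;
  hdot_eq0 : forall x, hdot x x = 0 -> x = 0 ;
  hdot_norm : forall x, `|x| ^+ 2 = `|hdot x x| }.

#[short(type="hilbertModType")]
HB.structure Definition HilbertModule (R : realType) (A : cstarAlgType R) :=
  {E of isHilbertModule R A E & CompleteNormedModule R[i] E}.

(* The norm of a complex normed space takes its values in R[i]. *)
Definition rnorm (R : realType) (V : normedModType R[i]) (v : V) : R :=
  complex.Re `|v|.

Section Operators.
Variables (R : realType) (A : cstarAlgType R) (E : hilbertModType A).
Implicit Types (t s : E -> E) (f g : R[i] -> R[i]).

Definition adjoint_of t s : Prop :=
  forall x y, hdot (t x) y = hdot x (s y) :> A.

(* Elements of L(E); linearity and boundedness are consequences. *)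
Definition adjointable t : Prop := exists s, adjoint_of t s.

Definition op_spectrum t : set R[i] :=
  [set z | ~ exists s, [/\ adjointable s,
      forall x, z *: s x - t (s x) = x &
      forall x, s (z *: x - t x) = x]].

Definition op_positive t : Prop :=
  [/\ adjointable t, adjoint_of t t & op_spectrum t `<=` [set z | 0 <= z]].

Definition spectrum_continuous t f : Prop :=
  {within (op_spectrum t : set (R[i] : numClosedFieldType)),
    continuous (f : (R[i] : numClosedFieldType) -> (R[i] : numClosedFieldType))}.

(* Phi is the unital *-homomorphism C(sp t) -> L(E) that sends the inclusion
   sp t -> C to t. An element of C(sp t) is represented by any function on C
   whose restriction to sp t it is. *)
Record functional_calculus t (Phi : (R[i] -> R[i]) -> E -> E) : Prop := {
  fc_adjointable : forall f, spectrum_continuous t f -> adjointable (Phi f) ;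
  fc_ext : forall f g, spectrum_continuous t f -> spectrum_continuous t g ->
    (forall z, op_spectrum t z -> f z = g z) -> Phi f = Phi g ;
  fc_add : forall f g, spectrum_continuous t f -> spectrum_continuous t g ->
    forall x, Phi (fun z => f z + g z) x = Phi f x + Phi g x ;
  fc_scale : forall (w : R[i]) f, spectrum_continuous t f ->
    forall x, Phi (fun z => w * f z) x = w *: Phi f x ;
  fc_mul : forall f g, spectrum_continuous t f -> spectrum_continuous t g ->
    forall x, Phi (fun z => f z * g z) x = Phi f (Phi g x) ;
  fc_star : forall f, spectrum_continuous t f ->
    adjoint_of (Phi f) (Phi (fun z => (f z)^*%R)) ;
  fc_one : forall x, Phi (fun=> 1) x = x ;
  fc_id : forall x, Phi (fun z => z) x = t x }.

(* s = t^r. On sp t, which lies in [0, +oo[ for positive t, the function below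
   is z |-> z^r. *)
Definition op_power t (r : R) s : Prop :=
  exists2 Phi, functional_calculus t Phi &
    s = Phi (fun z => ((complex.Re z `^ r)%R)%:C).

End Operators.

(* Main.v *)
(* A convex power lies above its tangents: [u^r >= c^r + r c^(r-1) (u - c)] for
   [r >= 1] and [c > 0], and the inequality is reversed for [r <= 1]. Applying
   the functional calculus of [t], pairing with [x] and taking norms in the
   C*-algebra gives, with [N = |<tx, x>|], [M = |<t^r x, x>|] and [X = |x|^2],
   [r c^(r-1) N <= M + (r - 1) c^r X], respectively
   [M <= r c^(r-1) N + (1 - r) c^r X]; the choice [c = N / X] is optimal. *)
Require Import Defs.
From HB Require Import structures.
From mathcomp Require Import all_boot all_order all_algebra complex.
From mathcomp Require Import all_classical all_reals all_analysis.
From mathcomp Require Import ring lra.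
Set Implicit Arguments.
Unset Strict Implicit.
Unset Printing Implicit Defensive.
Import Order.TTheory GRing.Theory Num.Theory.
Import numFieldNormedType.Exports.
Local Open Scope ring_scope.

(** * Real powers: continuity, tangent inequalities, and their optimization *)

Section PowR.
Local Open Scope classical_set_scope.

(** A negative base has the default power [1], so [u^r] alone jumps at [0]; truncating the base
    removes the jump. *)
Lemma continuous_powR_max0 (R : realType) (r : R) : 0 < r ->
  continuous (fun u : R => Num.max 0 u `^ r).
Proof.
move=> r0 u; have [u0|u0|u0] := ltgtP 0 u.
- have near_eq : \forall v \near u, Num.max 0 v `^ r = expR (r * ln v).
    near=> v; have v0 : 0 < v by near: v; exact: lt_nbhsr.
    by rewrite max_r ?ltW// /powR gt_eqF.
  have cvg_exp : expR (r * ln v) @[v --> u] --> Num.max 0 u `^ r.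
    rewrite max_r ?ltW// /powR gt_eqF//.
    apply: (@cvg_comp _ _ _ _ expR _ (nbhs (r * ln u))).
      by apply: cvgM; [exact: cvg_cst|exact: continuous_ln].
    exact: continuous_expR.
  apply: cvg_trans cvg_exp; apply: near_eq_cvg.
  by apply: filterS near_eq => v /= ->.
- rewrite /continuous_at max_l ?ltW//.
  have : (0 : R) `^ r @[_ --> u] --> (0 : R) `^ r by exact: cvg_cst.
  apply: cvg_trans; apply: near_eq_cvg; near=> v; rewrite max_l// ltW//.
  by near: v; exact: lt_nbhsl.
- rewrite /continuous_at -u0 maxxx powR0 ?gt_eqF//.
  apply/cvgrPdist_lt => e e0; near=> v.
  rewrite sub0r normrN ger0_norm ?powR_ge0//.
  (* Near [0] the radius [e^(1/r)] works, as its [r]-th power is [e]. *)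
  have -> : e = (e `^ r^-1) `^ r.
    by rewrite -powRrM mulVf ?gt_eqF// powRr1 ?ltW.
  apply: gt0_ltr_powR; rewrite ?nnegrE ?powR_ge0 ?le_max ?lexx//.
  rewrite gt_max powR_gt0//=.
  by near: v; apply: lt_nbhsl; rewrite ?powR_gt0.
Unshelve. all: by end_near. Qed.

(* Young's inequality for the exponents [r] and [r / (r - 1)]. *)
Lemma powR_ge_tangent (R : realType) (r c u : R) : 1 <= r -> 0 < c -> 0 <= u ->
  r * c `^ (r - 1) * u <= u `^ r + (r - 1) * c `^ r.
Proof.
(* At [r = 1] the conjugate exponent [r / (r - 1)] degenerates, but both sides equal [u]. *)
rewrite le_eqVlt => /predU1P[<-|r1] c0 u0.
  by rewrite subrr powRr0 powRr1// !mulr1 mul1r mul0r addr0.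
have r0 : 0 < r by exact: lt_trans r1.
have q0 : 0 < r - 1 by rewrite subr_gt0.
have := @conjugate_powR R u (c `^ (r - 1)) r (r / (r - 1)) u0 (powR_ge0 _ _) r0.
rewrite divr_gt0// => /(_ isT).
have -> : r^-1 + (r / (r - 1))^-1 = 1 by field; rewrite !gt_eqF.
move=> /(_ erefl); rewrite -powRrM [_ * (r / _)]mulrCA divff ?gt_eqF// mulr1.
move=> /(ler_wpM2l (ltW r0)) le_r.
rewrite -mulrA [c `^ _ * u]mulrC (le_trans le_r)// le_eqVlt; apply/orP; left.
by apply/eqP; field; rewrite !gt_eqF.
Qed.

(** Apply the convex case with exponent [1/r] at the point [c^r] to the argument [u^r], then
    multiply by [r c^(r-1)]. *)
Lemma powR_le_tangent (R : realType) (r c u : R) :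
  0 < r -> r <= 1 -> 0 < c -> 0 <= u ->
  u `^ r <= r * c `^ (r - 1) * u + (1 - r) * c `^ r.
Proof.
move=> r0 r1 c0 u0; have rV1 : 1 <= r^-1 by rewrite invf_ge1.
have := powR_ge_tangent rV1 (powR_gt0 r c0) (powR_ge0 u r).
rewrite -!powRrM mulrBr divff ?gt_eqF// mulr1.
rewrite (powRr1 u0) (powRr1 (ltW c0)) => le_t.
have k0 : 0 <= r * c `^ (r - 1) by rewrite mulr_ge0 ?powR_ge0 ?ltW.
have cc : c `^ (r - 1) * c `^ (1 - r) = 1.
  have sum0 : r - 1 + (1 - r) = 0 by ring.
  by rewrite -powRD ?(gt_eqF c0) ?implybT// sum0 powRr0.
have cr : c `^ (r - 1) * c = c `^ r by rewrite mulrC mulr_powRB1// ltW.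
have := ler_wpM2l k0 le_t.
have -> : r * c `^ (r - 1) * (r^-1 * c `^ (1 - r) * u `^ r) =
  (r / r) * (c `^ (r - 1) * c `^ (1 - r)) * u `^ r by ring.
rewrite cc divff ?gt_eqF// !mul1r mulrDr => /le_trans; apply.
have -> : r * c `^ (r - 1) * ((r^-1 - 1) * c) =
  (r / r - r) * (c `^ (r - 1) * c) by ring.
by rewrite cr divff ?gt_eqF// lexx.
Qed.

(* The hypotheses are optimized at [c = N / X]. *)
Lemma powR_le_of_tangents (R : realType) (r N X M : R) :
  1 <= r -> 0 <= N -> 0 < X -> 0 <= M ->
  (forall c, 0 < c -> r * c `^ (r - 1) * N <= M + (r - 1) * c `^ r * X) ->
  N `^ r <= X `^ (r - 1) * M.
Proof.
move=> r1 N0 X0 M0; have r0 : 0 < r by exact: lt_le_trans r1.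
move: N0; rewrite le_eqVlt => /predU1P[<- _|N0].
  by rewrite powR0 ?gt_eqF// mulr_ge0 ?powR_ge0.
have c0 : 0 < N / X by exact: divr_gt0.
move=> /(_ _ c0); set c := N / X in c0 *.
have Nc : N = c * X by rewrite /c divfK ?gt_eqF.
rewrite Nc.
(* With [N = c X] the hypothesis reads [r c^r X <= M + (r - 1) c^r X], that is, [c^r X <= M]. *)
have -> : r * c `^ (r - 1) * (c * X) = r * (c * c `^ (r - 1)) * X by ring.
rewrite (mulr_powRB1 (ltW c0) r0) (powRM _ (ltW c0) (ltW X0)).
rewrite -(mulr_powRB1 (ltW X0) r0) => le_M.
have -> : c `^ r * (X * X `^ (r - 1)) = X `^ (r - 1) * (c `^ r * X) by ring.
by rewrite ler_wpM2l ?powR_ge0//; lra.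
Qed.

Lemma powR_ge_of_tangents (R : realType) (r N X M : R) :
  0 < r -> r <= 1 -> 0 <= N -> 0 < X -> 0 <= M ->
  (forall c, 0 < c -> M <= r * c `^ (r - 1) * N + (1 - r) * c `^ r * X) ->
  X `^ (r - 1) * M <= N `^ r.
Proof.
move=> r0 r1 + X0; rewrite le_eqVlt => /predU1P[<-|N0] M0 hM.
  move: M0; rewrite le_eqVlt => /predU1P[<-|M0].
    by rewrite mulr0 powR_ge0.
  (* As [N = 0], the bound tends to [0] with [c]; here it is below [M]. *)
  have MX : 0 < M / (2 * X) by rewrite divr_gt0// mulr_gt0.
  have := hM _ (powR_gt0 r^-1 MX).
  rewrite mulr0 add0r -powRrM mulVf ?gt_eqF// (powRr1 (ltW MX)).
  have -> : (1 - r) * (M / (2 * X)) * X = (1 - r) * M / 2.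
    by field; rewrite gt_eqF.
  nra.
have c0 : 0 < N / X by exact: divr_gt0.
move: hM => /(_ _ c0); set c := N / X in c0 *.
have Nc : N = c * X by rewrite /c divfK ?gt_eqF.
rewrite Nc.
have -> : r * c `^ (r - 1) * (c * X) = r * (c * c `^ (r - 1)) * X by ring.
rewrite (mulr_powRB1 (ltW c0) r0) (powRM _ (ltW c0) (ltW X0)).
rewrite -(mulr_powRB1 (ltW X0) r0) => le_M.
have -> : c `^ r * (X * X `^ (r - 1)) = X `^ (r - 1) * (c `^ r * X) by ring.
by rewrite ler_wpM2l ?powR_ge0//; lra.
Qed.

End PowR.

(** * Norm laws for the real-valued norm *)

Section RealNorm.
Variables (R : realType) (V : normedModType R[i]).
Implicit Types v w : V.

Lemma rnormE v : `|v| = (rnorm v)%:C%C.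
Proof. by rewrite /rnorm RRe_real// ger0_real. Qed.

Lemma rnorm_ge0 v : 0 <= rnorm v.
Proof. by rewrite -lecR -rnormE normr_ge0. Qed.

Lemma rnorm_gt0 v : v != 0 -> 0 < rnorm v.
Proof. by rewrite -ltcR -rnormE normr_gt0. Qed.

Lemma ler_rnormD v w : rnorm (v + w) <= rnorm v + rnorm w.
Proof. by rewrite -lecR rmorphD /= -!rnormE ler_normD. Qed.

Lemma rnormZ (k : R) v : 0 <= k -> rnorm (k%:C%C *: v) = k * rnorm v.
Proof.
move=> k0; apply: complexI; rewrite rmorphM /= -!rnormE normrZ.
by rewrite (ger0_norm (x := k%:C%C)) ?lecR.
Qed.

End RealNorm.

(** * Continuity of the passages between the real line and the complex plane *)

Section Continuity.
Local Open Scope classical_set_scope.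
Variable R : realType.

Lemma continuous_Re :
  continuous (@complex.Re R : (R[i] : numClosedFieldType) -> R).
Proof.
move=> z P /nbhs_ballP[e /= e0 eP].
exists e%:C%C => [|w /= zw]; first by rewrite /= ltcR.
apply: eP; move: zw; rewrite /ball /=.
by rewrite -ltcR; apply: le_lt_trans; rewrite -raddfB normc_ge_Re.
Qed.

Lemma continuous_real_complex :
  continuous (real_complex R : R -> (R[i] : numClosedFieldType)).
Proof.
move=> u; apply/cvgrPdist_lt => e e0.
have eE : e = (complex.Re e)%:C%C by rewrite RRe_real// gtr0_real.
have : \forall v \near u, `|u - v| < complex.Re e.
  by apply: nbhsx_ballx; rewrite -ltcR -eE.
apply: filterS => v uv; rewrite -rmorphB /=.
by rewrite eE normc_def /= expr0n addr0 sqrtr_sqr ltcR.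
Qed.

End Continuity.

(** * Functional calculus of a positive operator on real functions *)

Section RealCalculus.
Variables (R : realType) (A : cstarAlgType R) (E : hilbertModType A).
Variables (t : E -> E) (Phi : (R[i] -> R[i]) -> E -> E).
Hypotheses (ht : op_positive t) (calc : functional_calculus t Phi).
Implicit Types (h g : R -> R) (x y : E).

(* Only the values of [h] on [[0, +oo[] matter; precomposing with [max 0] makes
   that restriction total, so continuity need not be relativized to a set. *)
Definition nneg_continuous h := continuous (fun u : R => h (Num.max 0 u)).

(** This is [h(t)]: on the spectrum of the positive operator [t], each [z] equals its real part. *)
Definition real_calc h := Phi (fun z => (h (complex.Re z))%:C%C).

Lemma op_spectrum_Re z : op_spectrum t z ->
  0 <= complex.Re z /\ (complex.Re z)%:C%C = z.
Proof.
case: ht => _ _ sp /sp /= z0.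
have zE : (complex.Re z)%:C%C = z by rewrite RRe_real// ger0_real.
by split => //; rewrite -lecR zE.
Qed.

(** On the spectrum the function agrees with its truncation by [max 0], which is continuous on the
    whole plane. *)
Lemma spectrum_continuous_real h : nneg_continuous h ->
  spectrum_continuous t (fun z => (h (complex.Re z))%:C%C).
Proof.
move=> ch; pose f (z : (R[i] : numClosedFieldType)) :
  (R[i] : numClosedFieldType) := (h (Num.max 0 (complex.Re z)))%:C%C.
have cf : continuous f.
  move=> z; apply: (@cvg_comp _ _ _ (@complex.Re R)
    (fun u => (h (Num.max 0 u))%:C%C) _ (nbhs (complex.Re z))).
    exact: continuous_Re.
  apply: (@cvg_comp _ _ _ (fun u => h (Num.max 0 u)) (real_complex R) _
    (nbhs (h (Num.max 0 (complex.Re z))))).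
    exact: ch.
  exact: continuous_real_complex.
apply: subspace_eq_continuous (continuous_subspaceT cf) => z.
by rewrite inE => /op_spectrum_Re[z0 _]; rewrite /f /from_subspace /= max_r.
Qed.

Lemma eq_Phi f h : nneg_continuous h -> spectrum_continuous t f ->
  (forall u, 0 <= u -> f u%:C%C = (h u)%:C%C) -> Phi f = real_calc h.
Proof.
move=> ch cf fh; apply: (fc_ext calc cf (spectrum_continuous_real ch)).
by move=> z /op_spectrum_Re[z0 zE]; rewrite -[in LHS]zE fh.
Qed.

(** A real function is its own conjugate, so [h(t)] is self-adjoint. *)
Lemma hdot_real_calcl h x y : nneg_continuous h ->
  hdot (real_calc h x) y = hdot x (real_calc h y) :> A.
Proof.
move=> /spectrum_continuous_real ch; rewrite (fc_star calc ch) /real_calc.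
by congr (hdot _ (Phi _ _)); apply/funext => z; exact: conjc_real.
Qed.

(** Asking for the product only on [[0, +oo[] allows two square roots of a function that is
    nonnegative just there to multiply to that function. *)
Lemma hdot_real_calcM h g k x : nneg_continuous h -> nneg_continuous g ->
  nneg_continuous k -> (forall u, 0 <= u -> h u * g u = k u) ->
  hdot (real_calc h x) (real_calc g x) = hdot x (real_calc k x) :> A.
Proof.
move=> ch cg ck hgk; rewrite hdot_real_calcl//.
rewrite /real_calc -(fc_mul calc (spectrum_continuous_real ch)
  (spectrum_continuous_real cg)).
have -> : (fun z => (h (complex.Re z))%:C%C * (g (complex.Re z))%:C%C) =
    (fun z => ((h (complex.Re z)) * (g (complex.Re z)))%:C%C) :> (R[i] -> R[i]).
  by apply/funext => z; rewrite rmorphM.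
have cM : nneg_continuous (fun u => h u * g u).
  by move=> u; apply: cvgM; [exact: ch|exact: cg].
rewrite (eq_Phi ck (spectrum_continuous_real cM))//.
by move=> u u0 /=; rewrite hgk.
Qed.

Lemma real_calcD h g k x : nneg_continuous h -> nneg_continuous g ->
  nneg_continuous k -> (forall u, 0 <= u -> h u + g u = k u) ->
  real_calc k x = real_calc h x + real_calc g x.
Proof.
move=> ch cg ck hgk.
rewrite /real_calc -(fc_add calc (spectrum_continuous_real ch)
  (spectrum_continuous_real cg)).
have -> : (fun z => (h (complex.Re z))%:C%C + (g (complex.Re z))%:C%C) =
    (fun z => ((h (complex.Re z)) + (g (complex.Re z)))%:C%C) :> (R[i] -> R[i]).
  by apply/funext => z; rewrite rmorphD.
have cD : nneg_continuous (fun u => h u + g u).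
  by move=> u; apply: cvgD; [exact: ch|exact: cg].
rewrite (eq_Phi ck (spectrum_continuous_real cD))//.
by move=> u u0 /=; rewrite hgk.
Qed.

Lemma real_calcZ (k : R) h x : nneg_continuous h ->
  real_calc (fun u => k * h u) x = k%:C%C *: real_calc h x.
Proof.
move=> /spectrum_continuous_real ch; rewrite /real_calc -(fc_scale calc _ ch).
by congr (Phi _ _); apply/funext => z; rewrite rmorphM.
Qed.

Lemma real_calc_id x : real_calc id x = t x.
Proof.
rewrite -[RHS](fc_id calc); congr (_ x); apply/esym/eq_Phi => //.
- by move=> u; apply: continuous_max; [exact: cvg_cst|exact: cvg_id].
- by apply: continuous_subspaceT => z; exact: cvg_id.
Qed.

Lemma real_calc1 x : real_calc (fun=> 1) x = x.
Proof. exact: (fc_one calc). Qed.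

Lemma rnorm_sqr x : rnorm x ^+ 2 = rnorm (hdot x x : A).
Proof. by apply: complexI; rewrite rmorphXn /= -!rnormE hdot_norm. Qed.

(* With [y] and [z] the values at [x] of the square roots of [h] and [g - h],
   [<x, g(t) x> = <y, y> + <z, z>]. As [<y, z> = <z, y>], this is the square of
   both [y + iz] and [y - iz], whose sum is [2y]; the triangle inequality in [E]
   then bounds the norm of [<y, y>] without any order theory in [A]. *)
Lemma ler_rnorm_real_calc h g x : nneg_continuous h -> nneg_continuous g ->
  (forall u, 0 <= u -> 0 <= h u <= g u) ->
  rnorm (hdot x (real_calc h x) : A) <= rnorm (hdot x (real_calc g x) : A).
Proof.
move=> ch cg hg.
have cd : nneg_continuous (fun u => g u - h u).
  by move=> u; apply: cvgB; [exact: cg|exact: ch].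
have csqrt k : nneg_continuous k -> nneg_continuous (fun u => Num.sqrt (k u)).
  move=> ck u; apply: (@cvg_comp _ _ _ (fun u => k (Num.max 0 u)) Num.sqrt _
    (nbhs (k (Num.max 0 u)))); [exact: ck|exact: sqrt_continuous].
have cs := csqrt _ ch; have cs' := csqrt _ cd.
have cM : nneg_continuous (fun u => Num.sqrt (h u) * Num.sqrt (g u - h u)).
  by move=> u; apply: cvgM; [exact: cs|exact: cs'].
set y := real_calc (fun u => Num.sqrt (h u)) x.
set z := real_calc (fun u => Num.sqrt (g u - h u)) x.
have yy : hdot y y = hdot x (real_calc h x) :> A.
  apply: hdot_real_calcM => // u /hg /andP[h0 _].
  by rewrite -expr2 sqr_sqrtr.
have zz : hdot z z = hdot x (real_calc (fun u => g u - h u) x) :> A.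
  apply: hdot_real_calcM => // u /hg /andP[_ hgu].
  by rewrite -expr2 sqr_sqrtr// subr_ge0.
have yz : hdot y z = hdot z y :> A.
  transitivity (hdot x
    (real_calc (fun u => Num.sqrt (h u) * Num.sqrt (g u - h u)) x) : A).
    exact: hdot_real_calcM.
  by apply/esym/hdot_real_calcM => // u _; rewrite mulrC.
(* Stated for [w = i] and [w = -i] at once: the cross terms cancel because [w] and its conjugate are
   opposite, and their product is [1]. *)
have sq (w : R[i]) : w * w = -1 -> (w^*)%R = - w ->
    hdot (y + w *: z) (y + w *: z) = hdot x (real_calc g x) :> A.
  move=> ww wC; rewrite hdotDr !hdotDl !hdotZr !hdotZl wC yy zz yz.
  rewrite !scalerA mulrN ww opprK scale1r.
  rewrite (@real_calcD h (fun u => g u - h u) g)//; last first.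
    by move=> u _; rewrite addrC subrK.
  by rewrite hdotDr scaleNr addrA -[_ - _ + _]addrA addNr addr0.
have ii : 'i%C * 'i%C = -1 :> R[i] by rewrite -expr2 sqr_i.
have iC : ('i%C : R[i])^*%R = - 'i%C.
  by apply/eqP; rewrite eq_complex /= oppr0 !eqxx.
set S := rnorm (hdot x (real_calc g x) : A).
have [n1 n2] : rnorm (y + 'i%C *: z) ^+ 2 = S /\
    rnorm (y + (- 'i%C) *: z) ^+ 2 = S.
  by rewrite !rnorm_sqr !sq// ?mulrNN// rmorphN /= iC.
have : 2 * rnorm y <= rnorm (y + 'i%C *: z) + rnorm (y + (- 'i%C) *: z).
  rewrite -rnormZ//; apply: le_trans (ler_rnormD _ _).
  rewrite scaleNr addrACA subrr addr0 rmorphMn /= rmorph1.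
  by rewrite scaler_nat.
rewrite -yy -rnorm_sqr -/S.
(* Both norms have square [S], so the triangle inequality becomes [|y| <= |y + iz|], which is then
   squared. *)
have n12 : rnorm (y + 'i%C *: z) = rnorm (y + (- 'i%C) *: z).
  by apply/eqP; rewrite -(eqrXn2 (n := 2)) ?rnorm_ge0// n1 n2 eqxx.
rewrite -n12 -n1 => le2.
rewrite ler_pXn2r ?nnegrE ?rnorm_ge0//; lra.
Qed.

(** Monotonicity is applied to [k h] and [a g + b]; the constant acts as [b] times the identity,
    whence the term in [|x|^2]. One form serves both tangents, with the identity and the power
    exchanging the roles of [h] and [g]. *)
Lemma ler_rnorm_real_calc_affine (k a b : R) h g x :
  nneg_continuous h -> nneg_continuous g -> 0 <= k -> 0 <= a -> 0 <= b ->
  (forall u, 0 <= u -> 0 <= h u /\ k * h u <= a * g u + b) ->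
  k * rnorm (hdot x (real_calc h x) : A) <=
  a * rnorm (hdot x (real_calc g x) : A) + b * rnorm x ^+ 2.
Proof.
move=> ch cg k0 a0 b0 hg.
have cst (c : R) : nneg_continuous (fun=> c) by move=> u; exact: cvg_cst.
have scaled (c : R) f : nneg_continuous f -> nneg_continuous (fun u => c * f u).
  by move=> cf u; apply: cvgM; [exact: cst|exact: cf].
have cag := scaled a _ cg; have cb := scaled b _ (cst 1).
have cagb : nneg_continuous (fun u => a * g u + b * 1).
  by move=> u; apply: cvgD; [exact: cag|exact: cb].
have := @ler_rnorm_real_calc _ _ x (scaled k _ ch) cagb.
rewrite (@real_calcD (fun u => a * g u) (fun=> b * 1)
  (fun u => a * g u + b * 1))//.
rewrite !real_calcZ// real_calc1 hdotDr !hdotZr rnormZ// rnorm_sqr => le_kN.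
rewrite -(rnormZ _ a0) -(rnormZ _ b0); apply: le_trans (ler_rnormD _ _).
apply: le_kN => u u0; have [h0 hkg] := hg u u0.
by rewrite mulr_ge0//= mulr1.
Qed.

End RealCalculus.

(** * The tangent inequalities carried over to [t] and its powers *)

Theorem theorem4p2 (R : realType) (A : cstarAlgType R) (E : hilbertModType A)
    (t : E -> E) (ht : op_positive t) (x : E) (hx : x != 0) :
  (forall (r : R) (tr : E -> E), 1 <= r -> op_power t r tr ->
     rnorm (hdot (t x) x : A) `^ r <=
     rnorm x `^ (2 * (r - 1)) * rnorm (hdot (tr x) x : A)) /\
  (forall (r : R) (tr : E -> E), 0 < r -> r <= 1 -> op_power t r tr ->
     rnorm x `^ (2 * (r - 1)) * rnorm (hdot (tr x) x : A) <=
     rnorm (hdot (t x) x : A) `^ r).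
Proof.
have X0 : 0 < rnorm x ^+ 2 by rewrite exprn_gt0 ?rnorm_gt0.
have powX r : rnorm x `^ (2 * (r - 1)) = (rnorm x ^+ 2) `^ (r - 1).
  by rewrite powRrM powR_mulrn ?rnorm_ge0.
have cid : nneg_continuous (@id R).
  by move=> u; apply: continuous_max; [exact: cvg_cst|exact: cvg_id].
have tangent_ge0 (r c : R) : 0 < r -> 0 < c -> 0 <= r * c `^ (r - 1).
  by move=> r0 c0; rewrite mulr_ge0 ?powR_ge0// ltW.
split=> r tr.
  move=> r1 [Phi calc trE]; have r0 : 0 < r by exact: lt_le_trans r1.
  have cpow : nneg_continuous (fun u => u `^ r) by exact: continuous_powR_max0.
  have trP : tr = real_calc Phi (fun u => u `^ r) by exact: trE.
  rewrite powX trP -(real_calc_id ht calc).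
  (* Self-adjointness moves both operators to the second argument, where the norm estimates
     apply. *)
  rewrite (hdot_real_calcl ht calc _ _ cid) (hdot_real_calcl ht calc _ _ cpow).
  apply: powR_le_of_tangents; rewrite ?rnorm_ge0// => c c0.
  rewrite -[X in _ <= X + _]mul1r.
  apply: (ler_rnorm_real_calc_affine ht calc); rewrite ?tangent_ge0//.
    by rewrite mulr_ge0 ?powR_ge0// subr_ge0.
  by move=> u u0; rewrite mul1r; split=> //; exact: powR_ge_tangent.
move=> r0 r1 [Phi calc trE].
have cpow : nneg_continuous (fun u => u `^ r) by exact: continuous_powR_max0.
have trP : tr = real_calc Phi (fun u => u `^ r) by exact: trE.
rewrite powX trP -(real_calc_id ht calc).
rewrite (hdot_real_calcl ht calc _ _ cid) (hdot_real_calcl ht calc _ _ cpow).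
apply: powR_ge_of_tangents; rewrite ?rnorm_ge0// => c c0.
(* Here the power is the smaller side, with [k = 1], and the identity carries the slope
   [a = r c^(r-1)]. *)
rewrite -[X in X <= _]mul1r.
apply: (ler_rnorm_real_calc_affine ht calc); rewrite ?tangent_ge0//.
  by rewrite mulr_ge0 ?powR_ge0// subr_ge0.
by move=> u u0; rewrite mul1r; split; [exact: powR_ge0|exact: powR_le_tangent].
Qed.
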